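(* Let $\alpha\in(0,1)$, $\gamma,\varepsilon>0$, $M\ge1$, $\Delta t>0$, and let $\tilde f=\tilde F'$ where $\tilde F$ is the truncated double-well potential $$\tilde F(u)=\begin{cases}\frac12(3M^2-1)(u-M)^2+(M^3-M)(u-M)+\frac14(M^2-1)^2,&u\ge M,\\ \frac14(u^2-1)^2,&u\in[-M,M],\\ \frac12(3M^2-1)(u+M)^2-(M^3-M)(u+M)+\frac14(M^2-1)^2,&u\le-M.\end{cases}$$ Let $(u^n)_{n\ge0}$ satisfy the L2 Adams--Bashforth scheme $$L_n^\alpha u=\gamma\big[\varepsilon^2\Delta u^n-2\tilde f(u^{n-1})+\tilde f(u^{n-2})-S\Delta t\,(u^n-u^{n-1})\big]\ \text{ in }\Omega,\qquad n\ge2,$$ with homogeneous Dirichlet boundary condition, where $L_n^\alpha$ is the L2 approximation of the Caputo derivative defined in the context. If $$S\ge\frac{3\alpha(3M^2-1)}{2(1+\alpha)}\left(\frac{3\gamma\,\Gamma(3-\alpha)(3M^2-1)}{2\alpha(1+\alpha)}\right)^{1/\alpha},$$ then $$\tilde E(u^n)\le\tilde E(u^{n-1})\qquad\text{for all }n\ge2,$$ where for $n\ge1$ $$\tilde E(u^n)=E(u^n)+\frac1\gamma\tilde D^n+\frac12(3M^2-1)\|u^n-u^{n-1}\|^2,$$ $$\tilde D^n=\frac{1}{\Gamma(3-\alpha)\Delta t^\alpha}\Big[\frac\alpha4\|u^n-u^{n-1}\|^2+\frac12\sum_{j=1}^{n-1}(d_{n-j}-d_{n-j+1})\|u^n-u^j\|^2+\frac{c_n}{2}\|u^n-u^1\|^2-\frac{a_n}{2}\|u^n-u^0\|^2\Big],$$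 and $E(u)=\int_\Omega\big(\frac{\varepsilon^2}{2}|\nabla u|^2+\tilde F(u)\big)dx$.
   Context: $\Omega\subset\mathbb{R}^d$ is a bounded domain with sufficiently regular boundary; $\|\cdot\|$ is the norm of $L^2(\Omega)$; $u^n\in H^2(\Omega)\cap H_0^1(\Omega)$ for all $n\ge 0$. Empty sums are zero. For $j\ge1$ put $$a_j=-\tfrac32(2-\alpha)(j+1)^{1-\alpha}+\tfrac12(2-\alpha)j^{1-\alpha}+(j+1)^{2-\alpha}-j^{2-\alpha},$$ $$b_j=2(2-\alpha)(j+1)^{1-\alpha}-2(j+1)^{2-\alpha}+2j^{2-\alpha},$$ $$c_j=-\tfrac12(2-\alpha)\big((j+1)^{1-\alpha}+j^{1-\alpha}\big)+(j+1)^{2-\alpha}-j^{2-\alpha},$$ and $d_1=c_1+2-2\alpha$, $d_j=c_j-a_{j-1}$ for $j\ge2$. The L2 approximation of the Caputo derivative of order $\alpha$ is, for $n\ge2$, $$L_n^\alpha u=\frac{1}{\Gamma(3-\alpha)\Delta t^\alpha}\Big\{\sum_{j=1}^{n-1}\big(a_ju^{n-j-1}+b_ju^{n-j}+c_ju^{n-j+1}\big)+\frac\alpha2u^{n-2}-2u^{n-1}+\frac{4-\alpha}{2}u^n\Big\}.$$ Equivalently, with $\delta u^j=u^j-u^{j-1}$, $L_n^\alpha u=\frac{1}{\Gamma(3-\alpha)\Delta t^\alpha}\big\{\frac{3\alpha}{2}\delta u^n-\frac\alpha2\delta u^{n-1}+\sum_{j=1}^nd_j\,\delta u^{n-j+1}-c_n\,\delta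 u^1\big\}$. *)

(* Defs.v *)
From HB Require Import structures.
From mathcomp Require Import all_boot all_order all_algebra.
From mathcomp Require Import all_classical all_reals all_analysis.

Set Implicit Arguments.
Unset Strict Implicit.
Unset Printing Implicit Defensive.
Import Order.TTheory GRing.Theory Num.Theory.
Import numFieldNormedType.Exports.
Local Open Scope classical_set_scope.
Local Open Scope ring_scope.

(* The library has Lebesgue measure on R only.  We equip 'rV[R]_d with
   the product (= Borel) sigma-algebra, as the library does for tuples, and
   build the measure by iterating the product measure. *)
Definition measure_rV_display : measure_display.
Proof. exact: default_measure_display. Qed.

Section measurable_rV.
Context {R : realType} (d : nat).

Let coord (i : 'I_d) (x : 'rV[R]_d) : R := x ord0 i.

Let rV_set0 : g_sigma_preimage coord set0.
Proof. exact: sigma_algebra0. Qed.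

Let rV_setC A : g_sigma_preimage coord A -> g_sigma_preimage coord (~` A).
Proof. exact: sigma_algebraC. Qed.

Let rV_bigcup (F : (set 'rV[R]_d)^nat) :
  (forall i, g_sigma_preimage coord (F i)) ->
  g_sigma_preimage coord (\bigcup_i (F i)).
Proof. exact: sigma_algebra_bigcup. Qed.

HB.instance Definition _ := @isMeasurable.Build measure_rV_display
  'rV[R]_d (g_sigma_preimage coord) rV_set0 rV_setC rV_bigcup.

End measurable_rV.

Section measurable_coord.
Context {R : realType} (d : nat).

Lemma measurable_coord (i : 'I_d) :
  measurable_fun [set: 'rV[R]_d] (fun x : 'rV[R]_d => x ord0 i).
Proof.
move=> _ A mA; rewrite setTI; apply: sub_sigma_algebra.
case: d i => [[] []//|n i].
rewrite -bigcup_mkord_ord; exists i; first exact: ltn_ord.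
by exists A => //; rewrite inord_val setTI.
Qed.

Lemma measurable_fun_coordP d' (T : measurableType d') (f : T -> 'rV[R]_d) :
  (forall i, measurable_fun [set: T] (fun t => f t ord0 i)) ->
  measurable_fun [set: T] f.
Proof.
move=> mf.
suff : g_sigma_preimage (fun i t => f t ord0 i) `<=` (@measurable _ T).
  move=> H _ A mA; rewrite setTI; apply: H.
  rewrite (g_sigma_preimage_comp (fun (i : 'I_d) (x : 'rV[R]_d) => x ord0 i) f).
  by exists A => //; rewrite setTI.
apply: smallest_sub; first exact: sigma_algebra_measurable.
case: d f mf => [|n] f mf; first by rewrite big_ord0.
rewrite -bigcup_mkord_ord; apply: bigcup_sub => i Ii.
by move=> A [B mB <-]; exact: mf.
Qed.

End measurable_coord.

Section lebesgue_rV_step.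
Context {R : realType} (d : nat).

Definition rV_cons (p : R * 'rV[R]_d) : 'rV[R]_d.+1 :=
  \row_i (if unlift ord0 i is Some j then p.2 ord0 j else p.1).

Definition rV_uncons (x : 'rV[R]_d.+1) : R * 'rV[R]_d :=
  (x ord0 ord0, \row_j x ord0 (lift ord0 j)).

Lemma rV_consK : cancel rV_cons rV_uncons.
Proof.
move=> [a v]; rewrite /rV_uncons mxE unlift_none; congr pair.
by apply/rowP => j; rewrite !mxE liftK.
Qed.

Lemma rV_unconsK : cancel rV_uncons rV_cons.
Proof.
move=> x; apply/rowP => i; rewrite mxE /=.
by case: unliftP => [j ->|->]; rewrite ?mxE.
Qed.

Lemma measurable_rV_cons : measurable_fun [set: (R * 'rV[R]_d)%type] rV_cons.
Proof.
apply: measurable_fun_coordP => i; rewrite /rV_cons.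
under eq_fun do rewrite mxE.
case: unliftP => [j _|_]; last exact: measurable_fst.
exact: (measurableT_comp (measurable_coord j) measurable_snd).
Qed.

Lemma measurable_rV_uncons : measurable_fun [set: 'rV[R]_d.+1] rV_uncons.
Proof.
apply/measurable_fun_pairP; split => /=; first exact: measurable_coord.
apply: measurable_fun_coordP => j /=.
by under eq_fun do rewrite mxE; exact: measurable_coord.
Qed.

Variable mu : {sigma_finite_measure set 'rV[R]_d -> \bar R}.

Definition lebesgue_rV_succ : set 'rV[R]_d.+1 -> \bar R :=
  pushforward (@lebesgue_measure R \x mu)%E rV_cons.

Let succ0 : lebesgue_rV_succ set0 = 0%E.
Proof. by rewrite /lebesgue_rV_succ /pushforward preimage_set0 measure0. Qed.

Let succ_ge0 A : (0 <= lebesgue_rV_succ A)%E.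
Proof. by rewrite /lebesgue_rV_succ /pushforward; exact: measure_ge0. Qed.

Let succ_sigma_additive : semi_sigma_additive lebesgue_rV_succ.
Proof.
exact: (@measure_semi_sigma_additive _ _ _
  (measure_function_pushforward__canonical__measure_function_Measure
     (lebesgue_measure \x mu)%E measurable_rV_cons)).
Qed.

HB.instance Definition _ := isMeasure.Build _ _ _
  lebesgue_rV_succ succ0 succ_ge0 succ_sigma_additive.

Let succ_sigma_finite : sigma_finite setT lebesgue_rV_succ.
Proof.
have /sigma_finiteP[F [FT ndF Foo]] := sigma_finiteT (@lebesgue_measure R).
have /sigma_finiteP[G [GT ndG Goo]] := sigma_finiteT mu.
exists (fun k => rV_uncons @^-1` (F k `*` G k)).
  rewrite -preimage_bigcup (_ : \bigcup_k (F k `*` G k) = setT) ?preimage_setT//.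
  apply/seteqP; split=> // -[x v] _.
  have [m _ Fmx] : (\bigcup_k F k) x by rewrite -FT.
  have [n _ Gnv] : (\bigcup_k G k) v by rewrite -GT.
  exists (maxn m n) => //; split => /=.
  - by move: x Fmx; exact/subsetPset/ndF/leq_maxl.
  - by move: v Gnv; exact/subsetPset/ndG/leq_maxr.
move=> k; have [mF Fk] := Foo k; have [mG Gk] := Goo k; split.
  rewrite -[X in measurable X]setTI; apply: measurable_rV_uncons => //.
  exact: measurableX.
rewrite /lebesgue_rV_succ /pushforward -comp_preimage.
rewrite (_ : rV_uncons \o rV_cons = id) ?preimage_id//; last first.
  by apply/funext => p /=; rewrite rV_consK.
by rewrite product_measure1E// lte_mul_pinfty// ge0_fin_numE.
Qed.

HB.instance Definition _ := Measure_isSigmaFinite.Build _ _ _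
  lebesgue_rV_succ succ_sigma_finite.

End lebesgue_rV_step.

Fixpoint lebesgue_rV {R : realType} (d : nat) :
    {sigma_finite_measure set 'rV[R]_d -> \bar R} :=
  if d is d'.+1 then lebesgue_rV_succ (lebesgue_rV d') else \d_(0 : 'rV[R]_0).

Lemma lebesgue_rV_box (R : realType) d (a b : 'I_d -> R) :
  (forall i, a i <= b i) ->
  lebesgue_rV d [set x | forall i, x ord0 i \in `[a i, b i]] =
  (\prod_(i < d) (b i - a i))%:E.
Proof.
elim: d a b => [|d IH] a b ab.
  rewrite big_ord0 /= diracE mem_set //= => -[].
  by [].
rewrite big_ord_recl EFinM /= /lebesgue_rV_succ /pushforward.
rewrite (_ : _ @^-1` _ = `[a ord0, b ord0]%classic `*`
  [set x : 'rV[R]_d | forall i, x ord0 i \in `[a (lift ord0 i), b (lift ord0 i)]]).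
  rewrite product_measure1E//; last first.
    rewrite (_ : [set x | _] = \bigcap_(i in [set: 'I_d]) ((fun x : 'rV[R]_d => x ord0 i) @^-1` `[a (lift ord0 i), b (lift ord0 i)]%classic)).
      apply: fin_bigcap_measurable => // i _; rewrite -[X in measurable X]setTI.
      exact: measurable_coord.
    by apply/seteqP; split => x /= h i; [move=> _|]; exact: h.
  rewrite IH //; first congr (_ * _)%E.
  have := lebesgue_measure_itv `[a ord0, b ord0]; rewrite /= lte_fin => -> .
  by case: ltP => // ba; rewrite (@le_anti _ _ (a ord0) (b ord0)) ?subrr ?ab.
apply/seteqP; split => -[x v] /=.
  move=> h; split; first by have := h ord0; rewrite mxE unlift_none.
  by move=> i; have := h (lift ord0 i); rewrite mxE liftK.
move=> [hx hv] i; rewrite mxE; case: unliftP => [j ->|->] //=.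
Qed.

Section sobolev.
Context {R : realType} {d : nat}.
Implicit Types (Omega : set 'rV[R]_d) (u g phi : 'rV[R]_d -> R).
Local Notation mu := (@lebesgue_rV R d).

(* Functions are total; only their values on Omega matter. *)
Definition L2 Omega u : Prop := u \_ Omega \in Lfun mu 2%:E.

Definition L2norm Omega u : R := fine 'N[mu]_2%:E[EFin \o (u \_ Omega)].

(* s = [:: i1; ...; ik] stands for the derivative d_i1 ... d_ik *)
Definition partials (s : seq 'I_d) phi : 'rV[R]_d -> R :=
  foldr (fun i psi => 'D_(delta_mx ord0 i) psi) phi s.

Definition smooth phi : Prop :=
  forall s, continuous (partials s phi) /\
    forall i x, derivable (partials s phi) x (delta_mx ord0 i).

Definition test_function Omega phi : Prop :=
  let supp := closure [set x | phi x != 0] in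
  [/\ smooth phi, compact supp & supp `<=` Omega].

Definition is_weak_deriv Omega (s : seq 'I_d) u g : Prop :=
  forall phi, test_function Omega phi ->
    \int[mu]_(x in Omega) (u x * partials s phi x) =
    (-1) ^+ size s * \int[mu]_(x in Omega) (g x * phi x).

Definition weak_derivs Omega (s : seq 'I_d) u : set ('rV[R]_d -> R) :=
  [set g | L2 Omega g /\ is_weak_deriv Omega s u g].

(* H^k(Omega) = W^{k,2}(Omega) *)
Definition sobolev Omega (k : nat) u : Prop :=
  L2 Omega u /\
  forall s : seq 'I_d, (size s <= k)%N -> weak_derivs Omega s u !=set0.

(* A representative of the weak derivative, which is unique up to a.e.
   equality on Omega; the default 0 is used when there is none in L^2. *)
Definition weak_deriv Omega (s : seq 'I_d) u : 'rV[R]_d -> R :=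
  xget (cst 0) (weak_derivs Omega s u).

Definition weak_grad_sqr Omega u (x : 'rV[R]_d) : R :=
  \sum_(i < d) weak_deriv Omega [:: i] u x ^+ 2.

Definition weak_laplacian Omega u (x : 'rV[R]_d) : R :=
  \sum_(i < d) weak_deriv Omega [:: i; i] u x.

(* H^1_0(Omega): closure of C_c^oo(Omega) in H^1(Omega) *)
Definition sobolev10 Omega u : Prop :=
  sobolev Omega 1 u /\
  exists phi : nat -> 'rV[R]_d -> R,
    [/\ forall k, test_function Omega (phi k),
        (fun k => L2norm Omega (phi k \- u)) @ \oo --> (0 : R) &
        forall i : 'I_d,
          (fun k => L2norm Omega
             (partials [:: i] (phi k) \- weak_deriv Omega [:: i] u))
            @ \oo --> (0 : R)].

Definition bounded_domain Omega : Prop :=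
  [/\ open Omega, connected Omega, Omega !=set0 & bounded_set Omega].

End sobolev.

Section scheme.
Context {R : realType}.

Definition Gamma (z : R) : R :=
  \int[lebesgue_measure]_(t in `]0, +oo[) (t `^ (z - 1) * expR (- t)).

Section L2_formula.
Variable alpha : R.

Definition coef_a (j : nat) : R :=
  - (3 / 2) * (2 - alpha) * j.+1%:R `^ (1 - alpha)
  + 1 / 2 * (2 - alpha) * j%:R `^ (1 - alpha)
  + j.+1%:R `^ (2 - alpha) - j%:R `^ (2 - alpha).

Definition coef_b (j : nat) : R :=
  2 * (2 - alpha) * j.+1%:R `^ (1 - alpha)
  - 2 * j.+1%:R `^ (2 - alpha) + 2 * j%:R `^ (2 - alpha).

Definition coef_c (j : nat) : R :=
  - (1 / 2) * (2 - alpha)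
    * (j.+1%:R `^ (1 - alpha) + j%:R `^ (1 - alpha))
  + j.+1%:R `^ (2 - alpha) - j%:R `^ (2 - alpha).

(* only used for 1 <= j *)
Definition coef_d (j : nat) : R :=
  if j == 1%N then coef_c 1 + 2 - 2 * alpha else coef_c j - coef_a j.-1.

(* only used for 2 <= n *)
Definition L2_caputo (dt : R) (n : nat) (v : nat -> R) : R :=
  (Gamma (3 - alpha) * dt `^ alpha)^-1 *
  (\sum_(1 <= j < n) (coef_a j * v (n - j - 1)%N + coef_b j * v (n - j)%N
                      + coef_c j * v (n - j + 1)%N)
   + alpha / 2 * v (n - 2)%N - 2 * v (n - 1)%N + (4 - alpha) / 2 * v n).

End L2_formula.

Definition trunc_potential (M u : R) : R :=
  if M <= u then
    1 / 2 * (3 * M ^+ 2 - 1) * (u - M) ^+ 2 + (M ^+ 3 - M) * (u - M)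
    + 1 / 4 * (M ^+ 2 - 1) ^+ 2
  else if - M <= u then 1 / 4 * (u ^+ 2 - 1) ^+ 2
  else
    1 / 2 * (3 * M ^+ 2 - 1) * (u + M) ^+ 2 - (M ^+ 3 - M) * (u + M)
    + 1 / 4 * (M ^+ 2 - 1) ^+ 2.

Context {d : nat} (Omega : set 'rV[R]_d).

Definition energy (eps M : R) (u : 'rV[R]_d -> R) : R :=
  \int[lebesgue_rV d]_(x in Omega)
    (eps ^+ 2 / 2 * weak_grad_sqr Omega u x + trunc_potential M (u x)).

(* for 1 <= n *)
Definition memory_term (alpha dt : R) (u : nat -> 'rV[R]_d -> R) (n : nat)
    : R :=
  (Gamma (3 - alpha) * dt `^ alpha)^-1 *
  (alpha / 4 * L2norm Omega (u n \- u (n - 1)%N) ^+ 2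
   + 1 / 2 * \sum_(1 <= j < n)
       (coef_d alpha (n - j) - coef_d alpha (n - j + 1))
       * L2norm Omega (u n \- u j) ^+ 2
   + coef_c alpha n / 2 * L2norm Omega (u n \- u 1%N) ^+ 2
   - coef_a alpha n / 2 * L2norm Omega (u n \- u 0%N) ^+ 2).

Definition modified_energy (alpha gamma eps M dt : R)
    (u : nat -> 'rV[R]_d -> R) (n : nat) : R :=
  energy eps M (u n) + gamma^-1 * memory_term alpha dt u n
  + 1 / 2 * (3 * M ^+ 2 - 1) * L2norm Omega (u n \- u (n - 1)%N) ^+ 2.

End scheme.

(* Main.v *)
Require Import Defs.
From HB Require Import structures.
From mathcomp Require Import all_boot all_order all_algebra.
From mathcomp Require Import all_classical all_reals all_analysis.
From mathcomp Require Import measurable_realfun.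
From mathcomp Require Import ring lra zify.
Import Order.TTheory GRing.Theory Num.Theory.
Import numFieldNormedType.Exports.
Local Open Scope classical_set_scope.
Local Open Scope ring_scope.
Set Implicit Arguments.
Unset Strict Implicit.
Unset Printing Implicit Defensive.

(** The energy decay rests on three facts that are almost independent of each
other: a positivity property of the discrete memory kernel, one-sided
quadratic bounds on the truncated potential, and integration by parts for
[H^2] functions against [H^1_0] functions.

_Kernel._ Substituting [G x = x^(2 - alpha)] and [g = G'], the coefficient
[c_j] is the error of the trapezoidal rule for [g] on [[j, j + 1]], and [- a_j]
is the integral over [[j, j + 1]] of [g'] against the positive weight
[1/2 + (x - j)].  Both functionals commute with the difference operator
[h |-> h - h (. + 1)], and every iterate of that operator keeps negative powers
of [x] nonnegative ([bdiffn_powR_ge0]).  Hence [c] and [- a] are nonnegative,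
nonincreasing and convex sequences, all by the same argument
([bdiffn_coef_c_ge0], [bdiffn_coef_aN_ge0]).  The sequence [d_j] inherits
convexity, except that its first term obeys a special rule; there an explicit
inequality between powers of 2 and 3 is needed ([coef_a12_ge0]).

_Memory inequality._ An Abel summation writes the discrete Caputo derivative at
step [n] as a combination of the differences [v_n - v_k] whose coefficients are
[d_(n-k) - d_(n-k+1)], [c_n] and [- a_(n-1)].  Multiplying by [v_n - v_(n-1)]
and using [2 (v_n - v_k) (v_n - v_(n-1)) = |v_n - v_k|^2 - |v_(n-1) - v_k|^2
+ |v_n - v_(n-1)|^2], the squares telescope into the increment of the memory
term, up to quantities whose signs are given by the monotonicity and convexity
above; [alpha |v_n - v_(n-1)|^2] is left over ([caputo_memory_ge]).

_Potential and stabilization._ With [L = 3 M^2 - 1], the force is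
[L]-Lipschitz and the potential lies below its tangent parabolas of curvature
[L], so that the extrapolated nonlinear term costs at most
[3/2 L |v_n - v_(n-1)|^2] once [L/2 |v_n - v_(n-1)|^2] has been added to the
energy.  The leftover of the memory inequality contributes a multiple of
[dt^(- alpha)] and the stabilizing term a multiple of [dt]; the condition on
[S] says precisely that the minimum over [dt > 0] of their sum is at least
[3/2 L] ([stabilization_bound]).

All of this is done at a single point [x], where the scheme reads as a relation
between real numbers ([energy_density_decay]): the density of the modified
energy without its gradient part increases by at most
[eps^2 lap (v_n - v_(n-1))].  Integrating over the domain and using [green]
turns this term into [- eps^2 int grad u_n . grad (u_n - u_(n-1))], which is at
most the decrease of the gradient energy. *)

(** * Iterated differences of powers and the coefficients of the L2 formula *)

Section differences.
Context {R : realType}.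
Implicit Types (h : R -> R) (x p : R).

Definition bdiff h : R -> R := fun x => h x - h (x + 1).

Lemma le_add1 x : x <= x + 1.
Proof. by rewrite lerDl. Qed.

Lemma MVT_gt0 (f df : R -> R) (a b : R) : 0 < a -> a <= b ->
  (forall x, 0 < x -> is_derive x 1 f (df x)) ->
  exists2 c, a <= c <= b & f b - f a = df c * (b - a).
Proof.
move=> a0 ab fdf.
have [c cab fE] : exists2 c, c \in `[a, b]%R & f b - f a = df c * (b - a).
  apply: MVT_segment => // [x|].
    by rewrite in_itv /= => /andP[ax _]; apply: fdf; exact: lt_trans ax.
  apply: derivable_within_continuous => x; rewrite in_itv /= => /andP[ax _].
  by have /@ex_derive := fdf x (lt_le_trans a0 ax).
by exists c => //; rewrite in_itv in cab.
Qed.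

Lemma is_derive_bdiff h dh : (forall x, 0 < x -> is_derive x 1 h (dh x)) ->
  forall x, 0 < x -> is_derive x 1 (bdiff h) (bdiff dh x).
Proof.
move=> hdh x x0; have hx := hdh x x0.
have hx1 := hdh (x + 1) (addr_gt0 x0 ltr01).
apply: is_deriveB.
have : is_derive x 1 (h \o (fun y => y + 1)) (dh (x + 1) * 1).
  by apply: is_derive1_comp; apply: is_derive_eq; rewrite addr0.
by rewrite mulr1.
Qed.

Lemma is_derive_bdiffn h dh : (forall x, 0 < x -> is_derive x 1 h (dh x)) ->
  forall k x, 0 < x -> is_derive x 1 (iter k bdiff h) (iter k bdiff dh x).
Proof. by move=> hdh; elim=> [|k IH] //; exact: is_derive_bdiff. Qed.

Lemma bdiffnZ a h k x :
  iter k bdiff (fun y => a * h y) x = a * iter k bdiff h x.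
Proof. by elim: k x => [|k IH] x //=; rewrite /bdiff !IH mulrBr. Qed.

Lemma is_derive_bdiffn_powR p k x : 0 < x ->
  is_derive x 1 (iter k bdiff (@powR R ^~ p))
    (p * iter k bdiff (@powR R ^~ (p - 1)) x).
Proof.
rewrite -bdiffnZ; move: x; exact: is_derive_bdiffn.
Qed.

(** By the mean value theorem one more difference of [x^p] is [- p] times a
lower-order difference of [x^(p - 1)] at an intermediate point, so the sign
propagates by induction on [k] for all [p <= 0] simultaneously. *)
Lemma bdiffn_powR_ge0 p k x : p <= 0 -> 0 < x ->
  0 <= iter k bdiff (@powR R ^~ p) x.
Proof.
elim: k p x => [|k IH] p x p0 x0 /=; first exact: powR_ge0.
have [c /andP[xc _] E] := MVT_gt0 x0 (le_add1 x)
  (is_derive_bdiffn_powR p k).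
rewrite /bdiff -opprB E oppr_ge0 addrAC subrr add0r mulr1.
apply: mulr_le0_ge0 => //; apply: IH; last exact: lt_le_trans xc.
by rewrite subr_le0 (le_trans p0).
Qed.

(** As a function of its right endpoint, the trapezoidal error has derivative
[(g y - g x - (y - x) g' y) / 2], which is nonnegative for concave [g]. *)
Lemma trapezoid_le (G g g1 g2 : R -> R) :
  (forall x, 0 < x -> is_derive x 1 G (g x)) ->
  (forall x, 0 < x -> is_derive x 1 g (g1 x)) ->
  (forall x, 0 < x -> is_derive x 1 g1 (g2 x)) ->
  (forall x, 0 < x -> g2 x <= 0) ->
  forall x, 0 < x -> (g x + g (x + 1)) / 2 <= G (x + 1) - G x.
Proof.
move=> dG dg dg1 g2le x x0.
(* The error as a function of the right endpoint [y], up to the constant [G x]. *)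
pose phi y := G y - (y - x) / 2 * (g x + g y).
have dphi (y : R) : 0 < y ->
    is_derive y 1 phi (2^-1 * (g y - g x - (y - x) * g1 y)).
  move=> y0; have := dG y y0; have := dg y y0 => ? ?.
  apply: is_derive_eq; rewrite /GRing.scale /=; rewrite mulr0; by field.
have [c /andP[xc cx1]] := MVT_gt0 x0 (le_add1 x) dphi.
have c0 : 0 < c by exact: lt_le_trans xc.
have [e /andP[xe ec] Eg] := MVT_gt0 x0 xc dg.
have e0 : 0 < e by exact: lt_le_trans xe.
have [e' /andP[ee' ec'] Eg1] := MVT_gt0 e0 ec dg1.
have g1e : g1 c <= g1 e.
  rewrite -subr_le0 Eg1; apply: mulr_le0_ge0; last by rewrite subr_ge0.
  by apply: g2le; exact: lt_le_trans ee'.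
have : 0 <= (c - x) * (g1 e - g1 c) by apply: mulr_ge0; rewrite subr_ge0.
rewrite /phi Eg subrr mul0r mul0r subr0; lra.
Qed.

(** For [G] convex, [G (x + 1) - G x] is at most the right-end slope [g (x + 1)],
and [g x <= g (x + 1)]. *)
Lemma convex_quadrature_ge0 (G g g1 : R -> R) :
  (forall x, 0 < x -> is_derive x 1 G (g x)) ->
  (forall x, 0 < x -> is_derive x 1 g (g1 x)) ->
  (forall x, 0 < x -> 0 <= g1 x) ->
  forall x, 0 < x -> G (x + 1) - G x <= 3 / 2 * g (x + 1) - g x / 2.
Proof.
move=> dG dg g1ge x x0.
have mono (y z : R) : 0 < y -> y <= z -> g y <= g z.
  move=> y0 yz; have [c /andP[yc _] E] := MVT_gt0 y0 yz dg.
  rewrite -subr_ge0 E mulr_ge0 ?subr_ge0// g1ge//; exact: lt_le_trans yc.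
have [c /andP[xc cx1] ->] := MVT_gt0 x0 (le_add1 x) dG.
have := mono _ _ (lt_le_trans x0 xc) cx1; have := mono _ _ x0 xc; lra.
Qed.

(** The derivatives of [bdiff^k (x^(2 - alpha))] up to order three, and the signs
of the last two: what [trapezoid_le] and [convex_quadrature_ge0] ask for. *)
Lemma powR_diff_signs al k x : 0 < al -> al < 1 -> 0 < x ->
  [/\ is_derive x 1 (iter k bdiff (@powR R ^~ (2 - al)))
        ((2 - al) * iter k bdiff (@powR R ^~ (1 - al)) x),
      is_derive x 1 (fun y => (2 - al) * iter k bdiff (@powR R ^~ (1 - al)) y)
        ((2 - al) * (1 - al) * iter k bdiff (@powR R ^~ (- al)) x),
      is_derive x 1
        (fun y => (2 - al) * (1 - al) * iter k bdiff (@powR R ^~ (- al)) y)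
        ((2 - al) * (1 - al) * (- al) * iter k bdiff (@powR R ^~ (- al - 1)) x),
      0 <= (2 - al) * (1 - al) * iter k bdiff (@powR R ^~ (- al)) x &
      (2 - al) * (1 - al) * (- al) * iter k bdiff (@powR R ^~ (- al - 1)) x <= 0].
Proof.
move=> al0 al1 x0.
have K0 : 0 <= (2 - al) * (1 - al) by apply: mulr_ge0; lra.
split.
- have := is_derive_bdiffn_powR (2 - al) k x0.
  by rewrite (_ : 2 - al - 1 = 1 - al)//; ring.
- have := is_derive_bdiffn_powR (1 - al) k x0.
  rewrite (_ : 1 - al - 1 = - al); last by ring.
  by move=> ?; apply: is_derive_eq; rewrite /GRing.scale /=; ring.
- have := is_derive_bdiffn_powR (- al) k x0.
  by move=> ?; apply: is_derive_eq; rewrite /GRing.scale /=; ring.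
- by apply: mulr_ge0 => //; apply: bdiffn_powR_ge0 => //; lra.
- apply: mulr_le0_ge0; last by apply: bdiffn_powR_ge0 => //; lra.
  by apply: mulr_ge0_le0 => //; lra.
Qed.

(** The coefficient [c] as a function of a real variable, written as the
trapezoidal error of the derivative of [x^(2 - alpha)]. *)
Definition coef_c_fun al x : R :=
  (x + 1) `^ (2 - al) - x `^ (2 - al)
  - ((2 - al) * x `^ (1 - al) + (2 - al) * (x + 1) `^ (1 - al)) / 2.

(** The opposite of the coefficient [a] as a function of a real variable, in the
shape of [convex_quadrature_ge0]. *)
Definition coef_aN_fun al x : R :=
  3 / 2 * ((2 - al) * (x + 1) `^ (1 - al)) - (2 - al) * x `^ (1 - al) / 2
  - ((x + 1) `^ (2 - al) - x `^ (2 - al)).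

(** The trapezoidal error is linear and invariant under translation, so its
differences are the trapezoidal errors of the differences of
[x^(2 - alpha)]. *)
Lemma bdiffn_coef_c_ge0 al k x : 0 < al -> al < 1 -> 0 < x -> 0 <= iter k bdiff (coef_c_fun al) x.
Proof.
move=> al0 al1 x0.
have -> : iter k bdiff (coef_c_fun al) x =
  iter k bdiff (@powR R ^~ (2 - al)) (x + 1) - iter k bdiff (@powR R ^~ (2 - al)) x
  - ((2 - al) * iter k bdiff (@powR R ^~ (1 - al)) x +
     (2 - al) * iter k bdiff (@powR R ^~ (1 - al)) (x + 1)) / 2.
  elim: k x {x0} => [|k IH] x //=.
  by rewrite /bdiff !IH; ring.
rewrite subr_ge0; pose S y := @powR_diff_signs al k y al0 al1.
by apply: (trapezoid_le (G := iter k bdiff (@powR R ^~ (2 - al)))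
  (g := fun y => (2 - al) * iter k bdiff (@powR R ^~ (1 - al)) y)
  (g1 := fun y => (2 - al) * (1 - al) * iter k bdiff (@powR R ^~ (- al)) y)
  (g2 := fun y => (2 - al) * (1 - al) * (- al) * iter k bdiff (@powR R ^~ (- al - 1)) y)
  _ _ _ _ x0) => y y0; have [] := S y y0.
Qed.

Lemma bdiffn_coef_aN_ge0 al k x : 0 < al -> al < 1 -> 0 < x -> 0 <= iter k bdiff (coef_aN_fun al) x.
Proof.
move=> al0 al1 x0.
have -> : iter k bdiff (coef_aN_fun al) x =
  3 / 2 * ((2 - al) * iter k bdiff (@powR R ^~ (1 - al)) (x + 1)) -
  (2 - al) * iter k bdiff (@powR R ^~ (1 - al)) x / 2 -
  (iter k bdiff (@powR R ^~ (2 - al)) (x + 1) - iter k bdiff (@powR R ^~ (2 - al)) x).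
  elim: k x {x0} => [|k IH] x //=.
  by rewrite /bdiff !IH; ring.
rewrite subr_ge0; pose S y := @powR_diff_signs al k y al0 al1.
by apply: (convex_quadrature_ge0 (G := iter k bdiff (@powR R ^~ (2 - al)))
  (g := fun y => (2 - al) * iter k bdiff (@powR R ^~ (1 - al)) y)
  (g1 := fun y => (2 - al) * (1 - al) * iter k bdiff (@powR R ^~ (- al)) y)
  _ _ _ x0) => y y0; have [] := S y y0.
Qed.

Lemma coef_cE al j : coef_c al j = coef_c_fun al j%:R.
Proof. by rewrite /coef_c /coef_c_fun -(natr1 j); field. Qed.

Lemma coef_aE al j : coef_a al j = - coef_aN_fun al j%:R.
Proof. by rewrite /coef_a /coef_aN_fun -(natr1 j); field. Qed.

Section coefs.
Variable al : R.
Hypotheses (al0 : 0 < al) (al1 : al < 1).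

Let natr_pos j : (0 < j)%N -> 0 < j%:R :> R. Proof. by rewrite ltr0n. Qed.

Lemma coef_c_ge0 j : (0 < j)%N -> 0 <= coef_c al j.
Proof. by move=> /natr_pos j0; rewrite coef_cE; exact: (bdiffn_coef_c_ge0 0). Qed.

Lemma coef_c_decr j : (0 < j)%N -> coef_c al j.+1 <= coef_c al j.
Proof.
move=> /natr_pos j0; rewrite !coef_cE -subr_ge0 -(natr1 j); exact: (bdiffn_coef_c_ge0 1).
Qed.

Lemma coef_c_convex j : (0 < j)%N ->
  0 <= coef_c al j - 2 * coef_c al j.+1 + coef_c al j.+2.
Proof.
move=> /natr_pos j0; rewrite !coef_cE -(natr1 j.+1) -(natr1 j).
by have := bdiffn_coef_c_ge0 2 al0 al1 j0; rewrite /= /bdiff; lra.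
Qed.

Lemma coef_a_incr j : (0 < j)%N -> coef_a al j <= coef_a al j.+1.
Proof.
move=> /natr_pos j0; rewrite !coef_aE -(natr1 j) lerN2 -subr_ge0; exact: (bdiffn_coef_aN_ge0 1).
Qed.

Lemma coef_a_concave j : (0 < j)%N ->
  coef_a al j - 2 * coef_a al j.+1 + coef_a al j.+2 <= 0.
Proof.
move=> /natr_pos j0; rewrite !coef_aE -(natr1 j.+1) -(natr1 j).
by have := bdiffn_coef_aN_ge0 2 al0 al1 j0; rewrite /= /bdiff; lra.
Qed.

Lemma powR_le1D x p : 1 <= x -> 0 <= p -> p <= 1 -> x `^ p <= 1 + p * (x - 1).
Proof.
move=> x1 p0 p1.
have d (y : R) : 0 < y -> is_derive y 1 (@powR R ^~ p) (p * y `^ (p - 1)).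
  exact: is_derive1_powR.
have [c /andP[c1 _]] := MVT_gt0 ltr01 x1 d.
rewrite powR1 => /eqP; rewrite subr_eq addrC => /eqP ->.
rewrite lerD2l ler_wpM2r ?subr_ge0// -[leRHS]mulr1 ler_wpM2l//.
by rewrite -[leRHS](powRr0 c) ler_powR// subr_le0.
Qed.

(** Bernoulli's inequality for nonpositive exponents, from [1 + s <= exp s] and
[ln x <= x - 1]. *)
Lemma powR_geD1 x p : 0 < x -> p <= 0 -> 1 + p * (x - 1) <= x `^ p.
Proof.
move=> x0 p0; rewrite /powR gt_eqF// (le_trans _ (expR_ge1Dx _))// lerD2l.
rewrite ler_wnM2l//.
have : ln (1 + (x - 1)) <= x - 1 by apply: le_ln1Dx; rewrite ltrBrDl subrr.
by rewrite subrKC.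
Qed.

(** The value [2 alpha - 2] stands in for the missing coefficient [a_0] in [d_1],
and the claim is the concavity of [a] at the first index with that value.  In
terms of [e = 1 - alpha] it reads
[3 e - 1 + 2^e (5 - 7 e) / 2 - 3^e 3 (1 - e) / 2 >= 0], an equality at both
[e = 0] and [e = 1]; splitting [3^e = 2^e (3/2)^e] and bounding the two factors
by linear functions of [e] is sharp enough. *)
Lemma coef_a12_ge0 : 0 <= 2 - 2 * al + 2 * coef_a al 1 - coef_a al 2.
Proof.
have [a0 a1] := (al0, al1); pose e := 1 - al.
have h32 : (3 / 2 : R) `^ e <= 1 + e * (3 / 2 - 1).
  by apply: powR_le1D; rewrite ?/e; lra.
have h2 : (2 : R) `^ e <= 1 + e * (2 - 1).
  by apply: powR_le1D; rewrite /e; lra.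
have h1 : 1 <= (2 : R) `^ e.
  by rewrite -[leLHS](powRr0 2) ler_powR ?ler1n// /e; lra.
have h3 : (3 : R) `^ e = 2 `^ e * (3 / 2) `^ e.
  by rewrite -powRM; [congr (_ `^ _); field|lra|lra].
have p2E : (2 : R) `^ (2 - al) = 2 * 2 `^ e.
  rewrite (_ : 2 - al = 1 + e); last by rewrite /e; ring.
  by rewrite powRD ?powRr1// pnatr_eq0 implybT.
have p3E : (3 : R) `^ (2 - al) = 3 * 3 `^ e.
  rewrite (_ : 2 - al = 1 + e); last by rewrite /e; ring.
  by rewrite powRD ?powRr1// pnatr_eq0 implybT.
rewrite /coef_a p2E p3E -/e h3 !powR1.
have alE : al = 1 - e by rewrite /e; ring.
have e0 : 0 < e by rewrite /e; lra.
have e1 : e < 1 by rewrite /e; lra.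
rewrite alE; clearbody e; move: (2 `^ e) ((3 / 2) `^ e) h32 h2 h1 => P Q h32 h2 h1.
have {h32} hQ : P * Q * (1 - e) <= P * (1 + e / 2) * (1 - e).
  by rewrite ler_wpM2r ?ler_wpM2l//; lra.
suff : 0 <= 3 * e - 1 + P * (1 - 11 / 4 * e + 3 / 4 * e ^+ 2) by lra.
(* After the bound on [(3/2)^e], the quadratic factor of [2^e] changes sign on
   the interval: [1 <= 2^e] serves where it is nonnegative, [2^e <= 1 + e]
   where it is negative. *)
have [q0|q0] := leP 0 (1 - 11 / 4 * e + 3 / 4 * e ^+ 2).
  have : (1 - 11 / 4 * e + 3 / 4 * e ^+ 2) <= P * (1 - 11 / 4 * e + 3 / 4 * e ^+ 2).
    by rewrite ler_peMl.
  nra.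
have : (1 + e) * (1 - 11 / 4 * e + 3 / 4 * e ^+ 2) <= P * (1 - 11 / 4 * e + 3 / 4 * e ^+ 2).
  by rewrite ler_wnM2r ?(ltW q0)//; lra.
have : 0 <= 3 / 4 * e * ((1 - e) * (5 / 3 - e)).
  by do 2 apply: mulr_ge0; lra.
lra.
Qed.

Lemma coef_d_convex j : (0 < j)%N ->
  0 <= coef_d al j - 2 * coef_d al j.+1 + coef_d al j.+2.
Proof.
case: j => [//|[_|j _]]; rewrite /coef_d /=.
  have := coef_c_convex (isT : 0 < 1)%N; have := coef_a12_ge0; lra.
have := coef_c_convex (isT : 0 < j.+2)%N.
have := coef_a_concave (isT : 0 < j.+1)%N; lra.
Qed.

Lemma coef_d1_ge0 : 0 <= coef_d al 1.
Proof. by have := coef_c_ge0 (isT : 0 < 1)%N; have a1 := al1; rewrite /coef_d /=; lra. Qed.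

End coefs.
End differences.

(** * The truncated double-well potential *)

Section potential.
Context {R : realType}.
Variable M : R.
Hypothesis M1 : 1 <= M.
Implicit Types x y u : R.

(** The projection onto [[- M, M]].  Both the potential and the force are
polynomials in [u] and [clamp u], which makes their estimates free of case
distinctions. *)
Definition clamp u : R := if M <= u then M else if - M <= u then u else - M.

(** The derivative of the truncated potential, see [derive1_trunc_potential]. *)
Definition trunc_force u : R :=
  (3 * M ^+ 2 - 1) * u - (3 * M ^+ 2 * clamp u - clamp u ^+ 3).

Lemma clamp_bounds u : - M <= clamp u <= M.
Proof.
have m := M1; rewrite /clamp; case: (lerP M u) => a; last case: (lerP (- M) u) => b; lra.
Qed.

Lemma clamp_le_lip x y : x <= y -> 0 <= clamp y - clamp x <= y - x.
Proof.
have m := M1; rewrite /clamp => xy; case: (lerP M x) => a; case: (lerP M y) => b;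
 case: (lerP (- M) x) => c; case: (lerP (- M) y) => e; lra.
Qed.

Lemma trunc_potentialE u : trunc_potential M u =
  (3 * M ^+ 2 - 1) / 2 * u ^+ 2 - (3 * M ^+ 2 * clamp u - clamp u ^+ 3) * u
  + (3 / 2 * M ^+ 2 * clamp u ^+ 2 - 3 / 4 * clamp u ^+ 4 + 1 / 4).
Proof.
rewrite /trunc_potential /clamp; case: (lerP M u) => a; last case: (lerP (- M) u) => b;
  by field.
Qed.

(** The variational inequality of the projection onto [[- M, M]]. *)
Lemma clamp_projP u (t : R) : - M <= t <= M ->
  0 <= (u - clamp u) * (clamp u - t).
Proof.
move=> /andP[t1 t2]; rewrite /clamp.
case: (lerP M u) => a; first by apply: mulr_ge0; lra.
case: (lerP (- M) u) => b; first by rewrite subrr mul0r.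
by apply: mulr_le0; lra.
Qed.

(** The bounded factor is the divided difference of [t |-> 3 M^2 t - t^3] on
[[- M, M]]. *)
Lemma cubic_factor_ge0 (s t : R) : - M <= s <= M -> - M <= t <= M ->
  0 <= 3 * M ^+ 2 - s ^+ 2 - s * t - t ^+ 2 <= 3 * M ^+ 2.
Proof.
move=> /andP[s1 s2] /andP[t1 t2].
have hs : 0 <= (M - s) * (M + s) by apply: mulr_ge0; lra.
have ht : 0 <= (M - t) * (M + t) by apply: mulr_ge0; lra.
have p1 : 0 <= (s - t) ^+ 2 by exact: sqr_ge0.
have p2 : 0 <= (s + t) ^+ 2 by exact: sqr_ge0.
have p3 : 0 <= s ^+ 2 by exact: sqr_ge0.
have p4 : 0 <= t ^+ 2 by exact: sqr_ge0.
by apply/andP; split; lra.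
Qed.

(** [L/2 u^2 - F u] is convex.  In terms of [s = clamp y] and [t = clamp x], its
distance to the tangent at [x] is a square times a nonnegative polynomial, plus
a term that is nonnegative by [clamp_projP]. *)
Lemma trunc_potential_le x y : trunc_potential M y <=
  trunc_potential M x + trunc_force x * (y - x) + (3 * M ^+ 2 - 1) / 2 * (y - x) ^+ 2.
Proof.
rewrite !trunc_potentialE /trunc_force.
have hs := clamp_bounds y; have ht := clamp_bounds x.
have /andP[W0 _] := cubic_factor_ge0 hs ht.
have hp := clamp_projP y ht.
move: (clamp x) (clamp y) hs ht W0 hp => t s /andP[s1 s2] /andP[t1 t2] W0 hp.
have h1 : 0 <= (y - s) * (s - t) * (3 * M ^+ 2 - s ^+ 2 - s * t - t ^+ 2).
  exact: mulr_ge0.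
have h2 : 0 <= (s - t) ^+ 2 *
    (3 / 2 * M ^+ 2 - (s ^+ 2 + 2 * s * t + 3 * t ^+ 2) / 4).
  apply: mulr_ge0; first exact: sqr_ge0.
  have hs : 0 <= (M - s) * (M + s) by apply: mulr_ge0; lra.
  have ht : 0 <= (M - t) * (M + t) by apply: mulr_ge0; lra.
  have : 0 <= (s - t) ^+ 2 by exact: sqr_ge0.
  lra.
lra.
Qed.

Lemma trunc_force_lip x y :
  `|trunc_force y - trunc_force x| <= (3 * M ^+ 2 - 1) * `|y - x|.
Proof.
wlog xy : x y / x <= y.
  move=> H; have [/H//|/ltW/H] := leP x y.
  by rewrite distrC (distrC x).
have m : 1 <= M ^+ 2 by rewrite exprn_ege1.
rewrite (ger0_norm (_ : 0 <= y - x)) ?subr_ge0//.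
rewrite /trunc_force.
have /andP[W0 W1] := cubic_factor_ge0 (clamp_bounds y) (clamp_bounds x).
have /andP[] := clamp_le_lip xy.
move: (clamp x) (clamp y) W0 W1 => t s W0 W1 st0 st1.
have h0 : 0 <= (s - t) * (3 * M ^+ 2 - s ^+ 2 - s * t - t ^+ 2) by exact: mulr_ge0.
have h1 : (s - t) * (3 * M ^+ 2 - s ^+ 2 - s * t - t ^+ 2) <= (y - x) * (3 * M ^+ 2).
  by apply: ler_pM.
have h2 : 0 <= (y - x) * (3 * M ^+ 2 - 2) by apply: mulr_ge0; lra.
by rewrite ler_norml; apply/andP; split; lra.
Qed.

(** Exchanging [x] and [y] in [trunc_potential_le] gives a lower bound with the
slope at [y], which the Lipschitz bound moves to [x].  The constant is not
optimal; the lemma serves to differentiate the potential. *)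
Lemma trunc_potential_ge x y :
  trunc_potential M x + trunc_force x * (y - x)
    - 3 / 2 * (3 * M ^+ 2 - 1) * (y - x) ^+ 2 <= trunc_potential M y.
Proof.
have h := trunc_potential_le y x.
have : (trunc_force x - trunc_force y) * (y - x) <= (3 * M ^+ 2 - 1) * (y - x) ^+ 2.
  apply: le_trans (ler_norm _) _; rewrite normrM -[X in _ <= _ * X]real_normK ?num_real//.
  by rewrite [`|y - x| ^+ 2]expr2 mulrA ler_wpM2r// distrC trunc_force_lip.
lra.
Qed.

(** This avoids gluing the derivatives of the three branches of the potential at
the points [M] and [- M]. *)
Lemma is_derive_of_quadratic_bound (F f : R -> R) (C x : R) :
  (forall y, `|F y - F x - f x * (y - x)| <= C * (y - x) ^+ 2) ->
  is_derive x 1 F (f x).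
Proof.
move=> H.
have C0 : 0 <= C.
  have := H (x + 1); rewrite [x + 1 - x]addrAC subrr add0r expr1n !mulr1.
  by apply: le_trans; exact: normr_ge0.
suff cv : h^-1 *: ((F \o shift x) (h *: 1) - F x) @[h --> 0^'] --> f x.
  by apply: DeriveDef; [apply/cvg_ex; exists (f x)|apply/cvg_lim].
apply/cvgrPdist_le => e e0; near=> h.
have h0 : h != 0 by near: h; exact: nbhs_dnbhs_neq.
have := H (h + x); rewrite addrK /= /GRing.scale /= mulr1 => Hh.
rewrite (_ : f x - _ = - (h^-1 * (F (h + x) - F x - f x * h))); last by field.
rewrite normrN normrM normfV ler_pdivrMl ?normr_gt0//.
apply: le_trans Hh _; rewrite -[X in _ * X]real_normK ?num_real// expr2.
rewrite mulrCA ler_wpM2l//.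
apply: (@le_trans _ _ ((C + 1) * `|h|)); first by rewrite ler_wpM2r// lerDl.
rewrite -ler_pdivlMl ?ltr_wpDl// mulrC.
near: h; apply: dnbhs0_le; rewrite divr_gt0// ltr_wpDl//.
Unshelve. all: end_near. Qed.

Lemma is_derive_trunc_potential x : is_derive x 1 (trunc_potential M) (trunc_force x).
Proof.
apply: (@is_derive_of_quadratic_bound _ _ (3 / 2 * (3 * M ^+ 2 - 1))) => y.
have m : 1 <= M ^+ 2 by rewrite exprn_ege1.
have h : 0 <= (3 * M ^+ 2 - 1) * (y - x) ^+ 2.
  by apply: mulr_ge0; [lra|exact: sqr_ge0].
rewrite ler_norml; apply/andP; split.
  by have := trunc_potential_ge x y; lra.
by have := trunc_potential_le x y; lra.
Qed.

Lemma derive1_trunc_potential x : derive1 (trunc_potential M) x = trunc_force x.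
Proof. by rewrite derive1E; have /@derive_val := is_derive_trunc_potential x. Qed.

Lemma continuous_trunc_potential : continuous (trunc_potential M).
Proof.
move=> x; apply: differentiable_continuous; apply/derivable1_diffP.
by have /@ex_derive := is_derive_trunc_potential x.
Qed.

Lemma clamp0 : clamp 0 = 0.
Proof. by have m := M1; rewrite /clamp; case: lerP => a; last case: lerP => b; lra. Qed.

Lemma trunc_potential_growth x :
  `|trunc_potential M x| <= 1 / 4 + 3 / 2 * (3 * M ^+ 2 - 1) * x ^+ 2.
Proof.
have := trunc_potential_le 0 x; have := trunc_potential_ge 0 x.
rewrite /trunc_force (trunc_potentialE 0) clamp0 !expr0n/= => h1 h2.
have m : 1 <= M ^+ 2 by rewrite exprn_ege1.
have h : 0 <= (3 * M ^+ 2 - 1) * x ^+ 2.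
  by apply: mulr_ge0; [lra|exact: sqr_ge0].
by rewrite ler_norml; apply/andP; split; lra.
Qed.

End potential.

(** * The memory inequality and the decay of the energy density *)

Section stability.
Context {R : realType}.
Variables (alpha : R).
Hypotheses (al0 : 0 < alpha) (al1 : alpha < 1).
Implicit Types v : nat -> R.

(** The discrete Caputo derivative without the factor
[1 / (Gamma dt^alpha)]. *)
Definition caputo_sum v n : R :=
  \sum_(1 <= j < n) (coef_a alpha j * v (n - j - 1)%N + coef_b alpha j * v (n - j)%N
                      + coef_c alpha j * v (n - j + 1)%N)
   + alpha / 2 * v (n - 2)%N - 2 * v (n - 1)%N + (4 - alpha) / 2 * v n.

(** The memory term of the energy at a single point: absolute values take the
place of the norms, and the factor [1 / (Gamma dt^alpha)] is left out. *)
Definition memory_sum v n : R :=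
  alpha / 4 * (v n - v (n - 1)%N) ^+ 2
   + 1 / 2 * \sum_(1 <= j < n)
       (coef_d alpha (n - j) - coef_d alpha (n - j + 1)) * (v n - v j) ^+ 2
   + coef_c alpha n / 2 * (v n - v 1%N) ^+ 2
   - coef_a alpha n / 2 * (v n - v 0%N) ^+ 2.

Lemma coef_abc0 j : coef_a alpha j + coef_b alpha j + coef_c alpha j = 0.
Proof. by rewrite /coef_a /coef_b /coef_c; field. Qed.

(* With this value at 0, [d_j = c_j - a_(j-1)] holds from [j = 1] on. *)
Let a0 j : R := if j is 0%N then 2 * alpha - 2 else coef_a alpha j.

Let coef_dE j : (0 < j)%N -> coef_d alpha j = coef_c alpha j - a0 j.-1.
Proof. by case: j => [//|[|j]] _; rewrite /coef_d /=; ring. Qed.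

(** Since [a_j + b_j + c_j = 0], only differences of [v] matter; with
[w_k = v_n - v_k] the summand at [k] is [(d_(n-k) - d_(n-k+1)) w_k] up to the
increment of [U_k = c_(n-k+1) w_k - a_(n-k) w_(k-1)], which telescopes. *)
Lemma caputo_sumE v m (n := m.+2) : caputo_sum v n =
  3 * alpha / 2 * (v n - v m.+1) - alpha / 2 * (v m.+1 - v m)
  + \sum_(1 <= k < n) (coef_d alpha (n - k) - coef_d alpha (n - k + 1)) * (v n - v k)
  + coef_c alpha n * (v n - v 1%N) - coef_a alpha m.+1 * (v n - v 0%N).
Proof.
pose w k := v n - v k.
pose U k := coef_c alpha (n - k + 1) * w k - a0 (n - k) * w k.-1.
have E k : (1 <= k < n)%N ->
    coef_a alpha (n - k) * v (k - 1)%N + coef_b alpha (n - k) * v k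
      + coef_c alpha (n - k) * v (k + 1)%N =
    (coef_d alpha (n - k) - coef_d alpha (n - k + 1)) * w k - (U k.+1 - U k).
  move=> /andP[k0 kn].
  rewrite /U (_ : (n - k.+1 + 1 = n - k)%N); last by lia.
  rewrite !coef_dE; [|lia|lia].
  rewrite (_ : (n - k).-1 = n - k.+1)%N; last by lia.
  rewrite (_ : (n - k + 1).-1 = n - k)%N; last by lia.
  rewrite (_ : a0 (n - k) = coef_a alpha (n - k)); last first.
    have nk0 : (0 < n - k)%N by lia.
    by case: (n - k)%N nk0.
  rewrite addn1 subn1 /w.
  have -> : coef_b alpha (n - k) = - coef_a alpha (n - k) - coef_c alpha (n - k).
    by have := coef_abc0 (n - k); lra.
  ring.
rewrite /caputo_sum big_nat_rev /=.
under eq_big_nat => k kn.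
  rewrite add1n subSS (_ : (n - (n - k) = k)%N); last by lia.
  rewrite E//; over.
rewrite sumrB telescope_sumr//.
rewrite /U /w subnn (_ : (n - 1)%N = m.+1)// (_ : (n - 2)%N = m); last by lia.
rewrite (_ : (m.+1 + 1)%N = n); last by lia.
by rewrite add0n /=; field.
Qed.

(** After the Abel summation the coefficients of the squares differ by one index
from those of the two memory terms, and each replacement loses a nonnegative
amount: by convexity of [d] and monotonicity of [c] in the older memory term,
by monotonicity of [a] in the newer one.  The identity
[d_n = c_n - a_(n-1)] makes the coefficients of the remaining
[|v_n - v_(n-1)|^2] add up to [d_1 / 2]. *)
Lemma caputo_memory_ge v m (n := m.+2) :
  memory_sum v n - memory_sum v m.+1 + alpha * (v n - v m.+1) ^+ 2 <=
  caputo_sum v n * (v n - v m.+1).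
Proof.
rewrite caputo_sumE -/n.
pose D k := coef_d alpha (n - k) - coef_d alpha (n - k + 1).
pose dl := v n - v m.+1.
have key : \sum_(1 <= k < n) D k * (v n - v k) * dl =
    1 / 2 * (\sum_(1 <= k < n) D k * (v n - v k) ^+ 2)
    - 1 / 2 * (\sum_(1 <= k < m.+1) D k * (v m.+1 - v k) ^+ 2)
    + (coef_d alpha 1 - coef_d alpha n) / 2 * dl ^+ 2.
  have -> : coef_d alpha 1 - coef_d alpha n = \sum_(1 <= k < n) D k.
    rewrite (eq_big_nat _ _ (F2 := fun k =>
        coef_d alpha (n - k.+1 + 1) - coef_d alpha (n - k + 1))).
      rewrite (telescope_sumr (fun k => coef_d alpha (n - k + 1))) //.
      by rewrite subnn (_ : (n - 1 + 1)%N = n)//; lia.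
    by move=> k kn; rewrite /D (_ : (n - k.+1 + 1 = n - k)%N)//; lia.
  have -> : \sum_(1 <= k < m.+1) D k * (v m.+1 - v k) ^+ 2 =
      \sum_(1 <= k < n) D k * (v m.+1 - v k) ^+ 2.
    by rewrite [RHS]big_nat_recr//= subrr expr0n/= mulr0 addr0.
  rewrite -[X in _ = _ + X]mulrA mulr_suml !mulr_sumr -sumrB -big_split/=.
  by apply: eq_bigr => k _; rewrite /dl; field.
have mono : \sum_(1 <= k < m.+1) D k * (v m.+1 - v k) ^+ 2 <=
    \sum_(1 <= k < m.+1)
      (coef_d alpha (m.+1 - k) - coef_d alpha (m.+1 - k + 1)) * (v m.+1 - v k) ^+ 2.
  apply: ler_sum_nat => k kn; rewrite ler_wpM2r ?sqr_ge0// /D.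
  have j0 : (0 < m.+1 - k)%N by lia.
  have := coef_d_convex al0 al1 j0.
  rewrite (_ : (n - k = (m.+1 - k).+1)%N); last by lia.
  by rewrite !addn1; lra.
have cd := coef_c_decr al0 al1 (isT : 0 < m.+1)%N.
have ai := coef_a_incr al0 al1 (isT : 0 < m.+1)%N.
have d1 := coef_d1_ge0 al0 al1.
have dn : coef_d alpha n = coef_c alpha n - coef_a alpha m.+1 by [].
rewrite /memory_sum (_ : (n - 1)%N = m.+1)// (_ : (m.+1 - 1)%N = m); last by lia.
rewrite -/(D _).
move: key; rewrite -mulr_suml => key.
set S1 := \sum_(1 <= k < n) D k * (v n - v k) in key *.
set S2 := \sum_(1 <= k < n) D k * (v n - v k) ^+ 2 in key *.
set S3 := \sum_(1 <= k < m.+1) D k * _ ^+ 2 in key mono.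
set S4 := \sum_(1 <= k < m.+1) _ in mono *.
rewrite -/dl.
have h1 : 0 <= (coef_c alpha m.+1 - coef_c alpha n) * (v m.+1 - v 1%N) ^+ 2.
  by apply: mulr_ge0; rewrite ?sqr_ge0 ?subr_ge0.
have h2 : 0 <= (coef_a alpha n - coef_a alpha m.+1) * (v n - v 0%N) ^+ 2.
  by apply: mulr_ge0; rewrite ?sqr_ge0 ?subr_ge0.
have h3 : 0 <= coef_d alpha 1 * dl ^+ 2 by apply: mulr_ge0; rewrite ?sqr_ge0.
have h4 : 0 <= alpha * (dl - (v m.+1 - v m)) ^+ 2.
  by apply: mulr_ge0; rewrite ?sqr_ge0 ?ltW.
move: h1 h2 h3 h4 key mono; rewrite dn /dl.
move: (coef_c alpha n) (coef_c alpha m.+1) (coef_a alpha n) (coef_a alpha m.+1).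
move: (coef_d alpha 1) (v n) (v m.+1) (v m) (v 1%N) (v 0%N) S1 S2 S3 S4 => *.
lra.
Qed.

(** In the rescaled step [y = dt th^(1/alpha)] the claim becomes
[1 + alpha <= y^(- alpha) + alpha y], with equality at the minimizer
[y = 1]. *)
Lemma stabilization_bound (A kappa dt S : R) : 0 < A -> 0 < kappa -> 0 < dt ->
  kappa * alpha / (1 + alpha) * (kappa / ((1 + alpha) * A)) `^ alpha^-1 <= S ->
  kappa <= A * (dt `^ alpha)^-1 + S * dt.
Proof.
move=> A0 k0 dt0 hS; have ap := al0.
set th := kappa / ((1 + alpha) * A) in hS *.
have th0 : 0 < th by rewrite divr_gt0// mulr_gt0//; lra.
pose y := th `^ alpha^-1 * dt.
have y0 : 0 < y by rewrite mulr_gt0// powR_gt0.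
have yE : A * (dt `^ alpha)^-1 = kappa / (1 + alpha) * y `^ (- alpha).
  rewrite /y powRM ?powR_ge0 ?ltW// -powRrM mulrN mulVf ?gt_eqF//.
  rewrite powR_inv1 ?ltW// powRN /th invf_div; field.
  by rewrite !gt_eqF ?powR_gt0//; lra.
have hS' : kappa / (1 + alpha) * (alpha * y) <= S * dt.
  rewrite (le_trans _ (ler_wpM2r (ltW dt0) hS))// /y le_eqVlt; apply/orP; left.
  by apply/eqP; field; lra.
have hy : 1 - alpha * (y - 1) <= y `^ (- alpha).
  by rewrite -mulNr powR_geD1//; lra.
have c0 : 0 <= kappa / (1 + alpha) by rewrite divr_ge0//; lra.
have kE : kappa = kappa / (1 + alpha) * (1 + alpha) by rewrite divfK//; lra.
rewrite yE [leLHS]kE; have := ler_wpM2l c0 hy; lra.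
Qed.

Section pointwise.
Variables (M gamma eps dt S : R).
Hypotheses (M1 : 1 <= M) (gamma0 : 0 < gamma).
Let L := 3 * M ^+ 2 - 1.
Let G := (Gamma (3 - alpha) * dt `^ alpha)^-1.
Hypothesis G0 : 0 < G.
Hypothesis stab : 3 / 2 * L <= alpha * G / gamma + S * dt.

(** The integrand of the modified energy, except for its gradient part. *)
Definition energy_density v n : R :=
  trunc_potential M (v n) + gamma^-1 * ((Gamma (3 - alpha) * dt `^ alpha)^-1 * memory_sum v n)
  + 1 / 2 * (3 * M ^+ 2 - 1) * (v n - v (n - 1)%N) ^+ 2.

(** The nonlinear part is split as [2 f(v_1) - f(v_0) = f(v_1) +
(f(v_1) - f(v_0))], where [v_0, v_1, v_n] are successive values: the first
summand is compared with the increment of the potential, the second is absorbed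
by the Lipschitz bound and Young's inequality. *)
Lemma energy_density_decay v lap m (n := m.+2) :
  L2_caputo alpha dt n v =
    gamma * (eps ^+ 2 * lap - 2 * trunc_force M (v m.+1) + trunc_force M (v m)
             - S * dt * (v n - v m.+1)) ->
  energy_density v n - energy_density v m.+1 <=
    eps ^+ 2 * (lap * (v n - v m.+1)).
Proof.
rewrite /L2_caputo -/(caputo_sum v n) -/G => scheme.
have gi : 0 < gamma^-1 by rewrite invr_gt0.
have := ler_wpM2l (ltW gi) (ler_wpM2l (ltW G0) (caputo_memory_ge v m)).
rewrite !(mulrA G (caputo_sum v n)) scheme.
rewrite /energy_density -/G -/L (_ : (n - 1)%N = m.+1)// (_ : (m.+1 - 1)%N = m); last by lia.
have L0 : 0 <= L by have m1 : 1 <= M ^+ 2 by [rewrite exprn_ege1]; rewrite /L; lra.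
have hF := trunc_potential_le M1 (v m.+1) (v n).
have hf : - (trunc_force M (v m.+1) - trunc_force M (v m)) * (v n - v m.+1) <=
    L / 2 * (v m.+1 - v m) ^+ 2 + L / 2 * (v n - v m.+1) ^+ 2.
  apply: le_trans (ler_norm _) _; rewrite normrM normrN.
  apply: (@le_trans _ _ (L * `|v m.+1 - v m| * `|v n - v m.+1|)).
    by rewrite ler_wpM2r// trunc_force_lip.
  rewrite -(real_normK (num_real (v m.+1 - v m))) -(real_normK (num_real (v n - v m.+1))).
  have : 0 <= L * (`|v m.+1 - v m| - `|v n - v m.+1|) ^+ 2.
    by rewrite mulr_ge0 ?sqr_ge0.
  lra.
have hstab : 3 / 2 * L * (v n - v m.+1) ^+ 2 <= (alpha * G / gamma + S * dt) * (v n - v m.+1) ^+ 2.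
  by rewrite ler_wpM2r ?sqr_ge0.
rewrite -/L in hF.
rewrite -[gamma * _ * _]mulrA mulKf ?gt_eqF// => mem.
move: hF hf hstab mem.
move: (memory_sum v n) (memory_sum v m.+1) (trunc_potential M (v n)) (trunc_potential M (v m.+1)).
move: (trunc_force M (v m.+1)) (trunc_force M (v m)) (v n) (v m.+1) (v m) => *.
lra.
Qed.
End pointwise.

End stability.

(** * Borel sets of row vectors *)

Section borel.
Context {R : realType} {d : nat}.
Local Notation mu := (@lebesgue_rV R d).

Lemma measurable_rV_rect (A : 'I_d -> set R) : (forall i, measurable (A i)) ->
  measurable [set x : 'rV[R]_d | forall i, A i (x ord0 i)].
Proof.
move=> mA; rewrite (_ : [set x | _] =
    \bigcap_(i in [set: 'I_d]) ((fun x : 'rV[R]_d => x ord0 i) @^-1` A i)).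
  apply: fin_bigcap_measurable => // i _; rewrite -[X in measurable X]setTI.
  exact: measurable_coord.
by apply/seteqP; split => x /= h i; [move=> _|]; exact: h.
Qed.

(** An open set is the union of the half-open cubes with vertices in
[Z^d / (k + 1)], for all [k], that it contains; there are countably many of
them. *)
Lemma measurable_open_rV (U : set 'rV[R]_d) : open U -> measurable U.
Proof.
move=> oU.
pose J (p : nat * {ffun 'I_d -> int}) i : set R :=
  `[(p.2 i)%:~R / p.1.+1%:R, ((p.2 i)%:~R + 1) / p.1.+1%:R[%classic.
pose Q p := [set x : 'rV[R]_d | forall i, J p i (x ord0 i)].
rewrite (_ : U = \bigcup_p (if `[< Q p `<=` U >] then Q p else set0)).
  apply: countable_bigcupT_measurable => [|p]; first exact: countableP.
  case: ifPn => _ //; apply: (measurable_rV_rect (A := J p)) => i.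
  exact: measurable_itv.
apply/seteqP; split => [x Ux|x [p _]]; last first.
  by case: asboolP => // QU; exact: QU.
have /nbhs_ballP[e /= e0 xeU] := open_nbhs_nbhs (conj oU Ux).
have [k ke] : exists k, k.+1%:R^-1 < e.
  by have [k _ hk] := near_infty_natSinv_lt (PosNum e0); exists k; exact: hk (leqnn _).
pose z := [ffun i : 'I_d => Num.floor (x ord0 i * k.+1%:R)].
have Qx : Q (k, z) x.
  move=> i; rewrite /J /= in_itv /= ffunE ler_pdivrMr// ltr_pdivlMr//.
  by have /andP[-> ] := floor_itv (x ord0 i * k.+1%:R); rewrite intrD.
exists (k, z) => //; case: asboolP => // nQ; exfalso; apply: nQ => y Qy.
apply: xeU; split => // i j; rewrite [i](ord1 i : i = ord0).
have := Qx j; have := Qy j; rewrite /ball /J /= !in_itv /=.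
move=> /andP[y1 y2] /andP[x1 x2]; rewrite ltr_norml.
have zE : ((z j)%:~R + 1) / k.+1%:R = (z j)%:~R / k.+1%:R + k.+1%:R^-1 :> R.
  by rewrite mulrDl mul1r.
move: x1 x2 y1 y2 ke; rewrite zE.
move: (x ord0 j) (y ord0 j) (k.+1%:R^-1) ((z j)%:~R / k.+1%:R) => p q r s *.
by apply/andP; split; lra.
Qed.

Lemma continuous_measurable_rV (f : 'rV[R]_d -> R) :
  continuous f -> measurable_fun setT f.
Proof.
move=> /continuousP cf; apply: (measurability _ (measurable_realfun.RGenOpens.measurableE R)).
move=> _ [_ [a [b ->] <-]]; rewrite setTI; apply: measurable_open_rV.
exact/cf/interval_open.
Qed.

Lemma bounded_set_fin_measure (A : set 'rV[R]_d) :
  measurable A -> bounded_set A -> (mu A < +oo)%E.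
Proof.
move=> mA [N [_ HN]].
pose K := `|N| + 1.
have K0 : 0 <= K by rewrite addr_ge0.
have AK x : A x -> `|x| <= K.
  by apply: (HN K); rewrite (le_lt_trans (ler_norm N))// ltrDl.
have := @lebesgue_rV_box R d (fun=> - K) (fun=> K) ltac:(by move=> i; rewrite ge0_cp).
set B := [set x | _] => muB.
apply: (@le_lt_trans _ _ (mu B)); last by rewrite muB ltry.
apply: le_measure; rewrite ?inE//.
  exact: (@measurable_rV_rect (fun=> `[- K, K]%classic)).
move=> x /AK xK i; rewrite in_itv /= -ler_norml; apply: le_trans xK.
rewrite [`|x|]mx_normrE.
by apply: (le_trans _ (le_bigmax _ _ (ord0, i))).
Qed.

End borel.

(** * Square-integrable functions *)

Section L2space.
Context {R : realType} {d : nat}.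
Local Notation mu := (@lebesgue_rV R d).
Variable Omega : set 'rV[R]_d.
Hypothesis mO : measurable Omega.
Implicit Types f g : 'rV[R]_d -> R.

Lemma L2B f g : L2 Omega f -> L2 Omega g -> L2 Omega (f \- g).
Proof.
rewrite /L2 => Lf Lg.
have -> : (f \- g) \_ Omega = f \_ Omega + - (g \_ Omega).
  by apply/funext => x; rewrite !fctE /= !patchE; case: ifP => //; rewrite subr0.
apply: (Lfun_addr_closed _ (lee1n 2)).2 => //.
exact: Lfun_oppr_closed.
Qed.

Lemma L2_integrableM f g : L2 Omega f -> L2 Omega g ->
  mu.-integrable Omega (EFin \o (fun x => f x * g x)).
Proof.
move=> Lf Lg; apply/(integrable_mkcond _ mO); rewrite restrict_EFin.
have /Lfun1_integrable := Lfun2_mul_Lfun1 Lf Lg; congr (mu.-integrable setT (EFin \o _)).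
by apply/funext => x; rewrite /= !patchE; case: ifP => //; rewrite mulr0.
Qed.

Lemma L2_integrable_sqr f : L2 Omega f ->
  mu.-integrable Omega (EFin \o (fun x => f x ^+ 2)).
Proof. by move=> Lf; exact: (L2_integrableM Lf Lf). Qed.

Lemma L2_measurable f : L2 Omega f -> measurable_fun Omega f.
Proof. by rewrite /L2 => /andP[/[!inE]/= mf _]; exact/measurable_restrictT. Qed.

(** No integrability is assumed: both sides vanish when the integral is
infinite. *)
Lemma L2norm_sqr f : L2norm Omega f ^+ 2 = \int[mu]_(x in Omega) f x ^+ 2.
Proof.
rewrite /L2norm -powR_mulrn ?fine_ge0 ?Lnorm_ge0//.
rewrite -fine_poweR poweR_Lnorm// Rintegral_mkcond; congr fine.
apply: eq_integral => x _; rewrite /= !patchE powR_mulrn//.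
by case: ifP => _; rewrite real_normK ?num_real// expr0n.
Qed.

Lemma L2_CauchySchwarz f g : L2 Omega f -> L2 Omega g ->
  `|\int[mu]_(x in Omega) (f x * g x)| <= L2norm Omega f * L2norm Omega g.
Proof.
move=> Lf Lg.
apply: le_trans (le_normr_Rintegral mO (L2_integrableM Lf Lg)) _.
move: (Lf) (Lg); rewrite /L2 => /andP[/[!inE]/= mf ff] /andP[/[!inE]/= mg fg].
have := @hoelder _ _ _ mu (f \_ Omega) (g \_ Omega) 2 2 mf mg.
move=> /(_ ltac:(by []) ltac:(by []) ltac:(by rewrite [RHS]splitr !div1r)).
have fin h : finite_norm mu 2%:E h -> ('N[mu]_2%:E[EFin \o h])%E \is a fin_num.
  by move=> hf; rewrite ge0_fin_numE ?Lnorm_ge0.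
rewrite Lnorm1 -lee_fin EFinM /Rintegral !fineK ?fin//; last first.
  by apply: integrable_fin_num => //; exact: (integrable_abse (L2_integrableM Lf Lg)).
move=> H; refine (le_trans _ H); rewrite integral_mkcond.
rewrite le_eqVlt; apply/orP; left; apply/eqP; apply: eq_integral => x _.
by rewrite /= !patchE; case: ifP => //; rewrite mulr0 normr0.
Qed.

Lemma L2_bounded (M : R) f : (mu Omega < +oo)%E -> measurable_fun setT f ->
  (forall x, `|f x| <= M) -> L2 Omega f.
Proof.
move=> Ofin mf fM; rewrite /L2.
have mfO : measurable_fun setT (f \_ Omega).
  by apply/(measurable_restrictT _ mO); apply: measurable_funTS; exact: mf.
apply/andP; split; rewrite inE//= /finite_norm unlock poweR_lty//.
rewrite (eq_integral (fun x => (((fun t => f t ^+ 2) \_ Omega) x)%:E)); last first.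
  move=> x _; rewrite /= !patchE powR_mulrn//.
  by case: ifP => _; rewrite real_normK ?num_real// expr0n.
apply: integrable_lty => //.
suff : mu.-integrable Omega (EFin \o (fun t => f t ^+ 2)).
  by move=> /(integrable_mkcond _ mO); rewrite restrict_EFin.
apply: measurable_bounded_integrable => //.
  by apply: measurable_funTS; exact: measurable_funX.
exists (M ^+ 2); split; first exact: num_real.
move=> y My x _; rewrite /= normrX (le_trans _ (ltW My))//.
by rewrite lerXn2r ?nnegrE// (le_trans _ (fM x)).
Qed.

End L2space.

(** * Test functions and integration by parts *)

Section testfunctions.
Context {R : realType} {d : nat}.
Local Notation mu := (@lebesgue_rV R d).
Variable Omega : set 'rV[R]_d.
Implicit Types phi : 'rV[R]_d -> R.

Lemma test_function_partial phi i : test_function Omega phi ->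
  test_function Omega (partials [:: i] phi).
Proof.
move=> [sphi cphi phiO].
have sub : closure [set x | partials [:: i] phi x != 0] `<=` closure [set x | phi x != 0].
  rewrite [X in _ `<=` X](iffLR (closure_id _) (@closed_closure _ _)).
  apply: closureS => x /= dphi; apply: contrapT => nx.
  have : open_nbhs x (~` closure [set x | phi x != 0]).
    by split => //; apply: closed_openC; exact: closed_closure.
  move=> /open_nbhs_nbhs nbx.
  move/eqP: dphi; apply.
  rewrite (@near_eq_derive _ _ _ phi (cst 0)) ?derive_cst//.
  near=> y; apply/eqP; rewrite -[_ == _]negbK; apply/negP => py.
  have : (~` closure [set x | phi x != 0]) y by near: y.
  by apply; apply: subset_closure.
split.
- move=> s; have := sphi (s ++ [:: i]).
  by rewrite /partials foldr_cat.
- exact: (subclosed_compact (@closed_closure _ _) cphi sub).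
- exact: (subset_trans sub phiO).
Unshelve. all: by end_near. Qed.

Lemma test_function_L2 phi : measurable Omega -> (mu Omega < +oo)%E ->
  test_function Omega phi -> L2 Omega phi.
Proof.
move=> mO Ofin [sphi cphi phiO].
have [cont _] := sphi [::].
have [N [_ HN]] : bounded_set (phi @` closure [set x | phi x != 0]).
  apply: compact_bounded; apply: continuous_compact => //.
  exact: continuous_subspaceT.
apply: (@L2_bounded _ _ _ _ (`|N| + 1)) => //.
  exact: continuous_measurable_rV.
move=> x; have [->|px] := eqVneq (phi x) 0; first by rewrite normr0 addr_ge0.
apply: (HN (`|N| + 1)); first by rewrite (le_lt_trans (ler_norm N))// ltrDl.
by exists x => //; exact: subset_closure.
Qed.

End testfunctions.

Section green.
Context {R : realType} {d : nat}.
Local Notation mu := (@lebesgue_rV R d).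
Variable Omega : set 'rV[R]_d.
Hypotheses (mO : measurable Omega) (Ofin : (mu Omega < +oo)%E).
Implicit Types u v : 'rV[R]_d -> R.

Lemma weak_derivP k s u : sobolev Omega k u -> (size s <= k)%N ->
  weak_derivs Omega s u (weak_deriv Omega s u).
Proof. by move=> [_ H] sk; apply: xgetPex; exact: H. Qed.

(** The derivative [d_i phi] is again a test function, so the weak formulation of
[d_i u] applies to it. *)
Lemma green_test (i : 'I_d) u (h g phi : 'rV[R]_d -> R) :
  weak_derivs Omega [:: i] u h -> weak_derivs Omega [:: i; i] u g ->
  test_function Omega phi ->
  \int[mu]_(x in Omega) (g x * phi x) =
  - \int[mu]_(x in Omega) (h x * partials [:: i] phi x).
Proof.
move=> [_ wh] [_ wg] tphi; have := wg _ tphi; rewrite sqrrN expr1n mul1r => <-.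
by have := wh _ (test_function_partial i tphi); rewrite expr1 mulN1r.
Qed.

(** Both sides are continuous in [v] for the [H^1] norm by the Cauchy-Schwarz
inequality, and they agree on test functions, which are dense in [H^1_0]. *)
Lemma green (i : 'I_d) u v : sobolev Omega 2 u -> sobolev10 Omega v ->
  \int[mu]_(x in Omega) (weak_deriv Omega [:: i; i] u x * v x) =
  - \int[mu]_(x in Omega) (weak_deriv Omega [:: i] u x * weak_deriv Omega [:: i] v x).
Proof.
move=> u2 [v1 [phi [tphi phiv dphiv]]].
have wg := weak_derivP u2 (isT : size [:: i; i] <= 2)%N.
have wh := weak_derivP u2 (isT : size [:: i] <= 2)%N.
have [Lw _] := weak_derivP v1 (isT : size [:: i] <= 1)%N.
have [Lv _] := v1.
move: wg wh Lw (dphiv i).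
set g := weak_deriv _ [:: i; i] u; set h := weak_deriv _ [:: i] u.
set w := weak_deriv _ [:: i] v => wg wh Lw {}dphiv.
have [[Lg _] [Lh _]] := (wg, wh).
apply/eqP; rewrite -subr_eq0 opprK -normr_le0.
have cv : (fun k => L2norm Omega g * L2norm Omega (phi k \- v)
    + L2norm Omega h * L2norm Omega (partials [:: i] (phi k) \- w)) @ \oo --> (0 : R).
  rewrite [X in _ --> X](_ : 0 = L2norm Omega g * 0 + L2norm Omega h * 0); last first.
    by rewrite !mulr0 addr0.
  by apply: cvgD; apply: cvgMr.
apply: (cvgr_to_ge cv); apply: nearW => k.
have Lp := test_function_L2 mO Ofin (tphi k).
have Ldp := test_function_L2 mO Ofin (test_function_partial i (tphi k)).
apply: le_trans (lerD (L2_CauchySchwarz mO Lg (L2B Lp Lv))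
                      (L2_CauchySchwarz mO Lh (L2B Ldp Lw))).
apply: le_trans (ler_normD _ _).
rewrite -normrN le_eqVlt; apply/orP; left; apply/eqP; congr (`| _ |).
under [X in _ = X + _]eq_Rintegral do rewrite /= mulrBr.
under [X in _ = _ + X]eq_Rintegral do rewrite /= mulrBr.
rewrite !RintegralB//; try exact: L2_integrableM.
rewrite (green_test wh wg (tphi k)); ring.
Qed.

End green.

(** * Positivity of the Gamma function *)

Section gamma.
Context {R : realType}.
Local Notation mu := (@lebesgue_measure R).

(** Equivalent to [ln (t / (2 p)) <= t / (2 p)]. *)
Lemma powR_expRN_le (p t : R) : 0 < p -> 0 < t ->
  t `^ p * expR (- t) <= (2 * p) `^ p * expR (- (t / 2)).
Proof.
move=> p0 t0; have pp0 : 0 < 2 * p by rewrite mulr_gt0.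
rewrite /powR !gt_eqF// -!expRD ler_expR.
have : ln (t / (2 * p)) <= t / (2 * p) by rewrite ltW// ln_sublinear// divr_gt0.
rewrite ln_div// => /(ler_wpM2l (ltW p0)).
rewrite (_ : p * (t / (2 * p)) = t / 2); last by field; lra.
lra.
Qed.

Lemma integrable_gamma (z : R) : 1 < z -> mu.-integrable `]0, +oo[%classic
  (EFin \o (fun t : R => t `^ (z - 1) * expR (- t))).
Proof.
move=> z1; have p0 : 0 < z - 1 by rewrite subr_gt0.
have : mu.-integrable `]0, +oo[%classic
    ((EFin \o exponential_pdf (2^-1 : R)) \* cst (2 * (2 * (z - 1)) `^ (z - 1))%:E)%E.
  apply: (@integrableS _ _ _ _ setT) => //.
  apply: (integrableZr measurableT (2 * (2 * (z - 1)) `^ (z - 1))).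
  by apply: integrable_exponential_pdf; lra.
apply: le_integrable => //.
  apply/measurable_EFinP; apply: measurable_funTS; apply: measurable_funM.
    exact: measurable_powR.
  by apply: measurableT_comp => //.
move=> t /=; rewrite in_itv /= andbT => t0.
rewrite lee_fin ger0_norm ?mulr_ge0 ?powR_ge0 ?expR_ge0//.
rewrite exponential_pdfE ?(ltW t0)//; apply: (le_trans _ (ler_norm _)).
apply: le_trans (powR_expRN_le p0 t0) _.
rewrite (_ : - 2^-1 * t = - (t / 2)); last by field.
by rewrite le_eqVlt; apply/orP; left; apply/eqP; field.
Qed.

(** The integral is finite because the integrand is dominated by an exponential
density, and it is at least the integral of [exp (- 2)] over [[1, 2]]. *)
Lemma Gamma_gt0 (z : R) : 1 < z -> 0 < Gamma z.
Proof.
move=> z1; have iG := integrable_gamma z1.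
set g := fun t : R => t `^ (z - 1) * expR (- t) in iG.
have sub : (`[1, 2]%classic : set R) `<=` `]0, +oo[%classic.
  by move=> t /=; rewrite !in_itv /= andbT => /andP[t1 _]; lra.
have i12 : mu.-integrable `[1, 2]%classic (EFin \o g) by exact: integrableS iG.
have mu12 : mu `[1%R, 2%R]%classic = 1%E.
  rewrite lebesgue_measure_itv /= lte_fin ltr1n -EFinB; congr EFin; lra.
apply: (@lt_le_trans _ _ (\int[mu]_(t in `[1, 2]) (expR (- 2)))).
  by rewrite Rintegral_cst// [X in fine X]mu12 mulr1 expR_gt0.
apply: (@le_trans _ _ (\int[mu]_(t in `[1, 2]) g t)).
  apply: le_Rintegral => //.
    apply/integrableP; split; first exact/measurable_EFinP.
    rewrite (eq_integral (cst (expR (- 2))%:E)).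
      by rewrite integral_cst// [X in (_ * X)%E]mu12 mule1 ltry.
    by move=> x _; rewrite /= ger0_norm// expR_ge0.
  move=> t /=; rewrite in_itv /= => /andP[t1 t2]; rewrite /g.
  rewrite -[leLHS]mul1r ler_pM ?expR_ge0 ?ler_expR ?lerN2//.
  by rewrite -[leLHS](powRr0 t) ler_powR// subr_ge0 ltW.
rewrite /Gamma /Rintegral fine_le//; [exact: integrable_fin_num..|].
apply: ge0_subset_integral => //.
  by have /integrableP[] := iG.
by move=> t _; rewrite lee_fin mulr_ge0 ?powR_ge0 ?expR_ge0.
Qed.

End gamma.

(** * Integration of the energy density *)

Section integration.
Context {R : realType} {d : nat}.
Local Notation mu := (@lebesgue_rV R d).
Variable Omega : set 'rV[R]_d.
Hypotheses (mO : measurable Omega) (Ofin : (mu Omega < +oo)%E).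
Implicit Types f g : 'rV[R]_d -> R.

(** Integrability and value together, so that the integral of a long sum of terms
is computed by following the structure of the integrand. *)
Definition has_integral f (I : R) :=
  mu.-integrable Omega (EFin \o f) /\ \int[mu]_(x in Omega) f x = I.

Lemma has_integralD f g I J : has_integral f I -> has_integral g J ->
  has_integral (fun x => f x + g x) (I + J).
Proof.
move=> [fi <-] [gi <-]; split; last exact: RintegralD.
exact: (integrableD mO fi gi).
Qed.

Lemma has_integralZ k f I : has_integral f I ->
  has_integral (fun x => k * f x) (k * I).
Proof.
move=> [fi <-]; split; last exact: RintegralZl.
exact: (integrableZl mO k fi).
Qed.

Lemma has_integralB f g I J : has_integral f I -> has_integral g J ->
  has_integral (fun x => f x - g x) (I - J).
Proof.
move=> [fi <-] [gi <-]; split; last exact: RintegralB.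
exact: (integrableB mO fi gi).
Qed.

Lemma has_integral0 : has_integral (fun=> 0) 0.
Proof. by split; [exact: integrable0|rewrite Rintegral_cst// mul0r]. Qed.

Lemma has_integral_sum (J : Type) (r : seq J) (P : pred J) (F : J -> 'rV[R]_d -> R) (I : J -> R) :
  (forall j, P j -> has_integral (F j) (I j)) ->
  has_integral (fun x => \sum_(j <- r | P j) F j x) (\sum_(j <- r | P j) I j).
Proof.
move=> FI; elim: r => [|j r IH].
  by rewrite big_nil; under eq_fun do rewrite big_nil; exact: has_integral0.
rewrite big_cons; under eq_fun do rewrite big_cons.
by case: ifP => // Pj; apply: has_integralD => //; exact: FI.
Qed.

Lemma has_integral_sqrB f g : L2 Omega f -> L2 Omega g ->
  has_integral (fun x => (f x - g x) ^+ 2) (L2norm Omega (f \- g) ^+ 2).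
Proof.
move=> Lf Lg; split; last by rewrite L2norm_sqr.
exact: (L2_integrable_sqr mO (L2B Lf Lg)).
Qed.

(** The nonnegative function [|g - f|] equals [g - f] almost everywhere. *)
Lemma has_integral_le_ae f g I J : has_integral f I -> has_integral g J ->
  {ae mu, forall x, Omega x -> f x <= g x} -> I <= J.
Proof.
move=> [fi <-] [gi <-] fg.
have mf := measurable_int _ fi; have mg := measurable_int _ gi.
rewrite -subr_ge0 -RintegralB//.
rewrite (_ : \int[mu]_(x in Omega) (g x - f x) =
             \int[mu]_(x in Omega) `|g x - f x|); first exact: Rintegral_ge0.
congr fine; apply: ae_eq_integral => //.
- by apply/measurable_EFinP; apply: measurable_funB; exact/measurable_EFinP.
- apply/measurable_EFinP; apply: measurableT_comp => //.
  by apply: measurable_funB; exact/measurable_EFinP.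
- apply: filterS fg => x fg Ox; rewrite ger0_norm// subr_ge0; exact: fg.
Qed.

Lemma has_integral_energy (M eps : R) u : 1 <= M -> sobolev Omega 1 u ->
  has_integral
    (fun x => eps ^+ 2 / 2 * weak_grad_sqr Omega u x + trunc_potential M (u x))
    (energy Omega eps M u).
Proof.
move=> M1 u1; have [Lu _] := u1.
have grad : mu.-integrable Omega (EFin \o weak_grad_sqr Omega u).
  apply: (proj1 (@has_integral_sum _ _ _ (fun i x => weak_deriv Omega [:: i] u x ^+ 2)
    (fun i => \int[mu]_(x in Omega) weak_deriv Omega [:: i] u x ^+ 2) _)) => i _.
  split => //; apply: L2_integrable_sqr => //.
  by have [] := weak_derivP u1 (isT : size [:: i] <= 1)%N.
have pot : mu.-integrable Omega (EFin \o (fun x => trunc_potential M (u x))).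
  pose b x := 1 / 4 + 3 / 2 * (3 * M ^+ 2 - 1) * u x ^+ 2.
  apply: (@le_integrable _ _ _ _ _ mO _ (EFin \o b)).
  - apply/measurable_EFinP.
    apply: (measurableT_comp (continuous_measurable_fun (continuous_trunc_potential M1))).
    exact: L2_measurable.
  - move=> x _; rewrite lee_fin; apply: (le_trans _ (ler_norm _)).
    exact: trunc_potential_growth.
  - apply: (proj1 (has_integralD (I := 1 / 4 * fine (mu Omega))
      (J := 3 / 2 * (3 * M ^+ 2 - 1) * \int[mu]_(x in Omega) u x ^+ 2) _ _)).
      split; last by rewrite Rintegral_cst.
      apply: measurable_bounded_integrable => //.
      exists `|1 / 4|; split; first exact: num_real.
      by move=> y hy z _; exact: ltW.
    by apply: has_integralZ; split => //; exact: L2_integrable_sqr.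
split => //.
exact: (integrableD mO (integrableZl mO (eps ^+ 2 / 2) grad) pot).
Qed.

(** The squared norms in the memory term and in the last term of the modified
energy are integrals of the squares that occur in [energy_density]. *)
Lemma has_integral_energy_density (alpha gamma eps M dt : R)
    (u : nat -> 'rV[R]_d -> R) n : 1 <= M -> (forall n, sobolev Omega 2 (u n)) ->
  has_integral (fun x => eps ^+ 2 / 2 * weak_grad_sqr Omega (u n) x
      + energy_density alpha M gamma dt (fun k => u k x) n)
    (modified_energy Omega alpha gamma eps M dt u n).
Proof.
move=> M1 u2.
have Lu k : L2 Omega (u k) by have [] := u2 k.
have u1 : sobolev Omega 1 (u n).
  by have [? H] := u2 n; split => // s sk; apply: H; exact: leq_trans sk _.
rewrite /energy_density; under eq_fun do rewrite !addrA.
rewrite /modified_energy /memory_term /memory_sum.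
apply: has_integralD.
  apply: has_integralD; first exact: has_integral_energy.
  do 2 apply: has_integralZ; apply: has_integralB.
    apply: has_integralD; last by apply: has_integralZ; exact: has_integral_sqrB.
    apply: has_integralD; first by apply: has_integralZ; exact: has_integral_sqrB.
    apply: has_integralZ; apply: has_integral_sum => j _.
    by apply: has_integralZ; exact: has_integral_sqrB.
  by apply: has_integralZ; exact: has_integral_sqrB.
by apply: has_integralZ; exact: has_integral_sqrB.
Qed.

End integration.
Unset Implicit Arguments.

Theorem theorem4p2 (R : realType) (d : nat) (d_gt0 : (0 < d)%N)
    (Omega : set 'rV[R]_d) (dom : bounded_domain Omega)
    (alpha gamma eps M dt S : R)
    (alpha_gt0 : 0 < alpha) (alpha_lt1 : alpha < 1)
    (gamma_gt0 : 0 < gamma) (eps_gt0 : 0 < eps)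
    (M_ge1 : 1 <= M) (dt_gt0 : 0 < dt)
    (u : nat -> 'rV[R]_d -> R)
    (uH2 : forall n, sobolev Omega 2 (u n))
    (uH10 : forall n, sobolev10 Omega (u n))
    (scheme : forall n, (2 <= n)%N ->
      {ae lebesgue_rV d, forall x, Omega x ->
        L2_caputo alpha dt n (fun k => u k x) =
        gamma * (eps ^+ 2 * weak_laplacian Omega (u n) x
                 - 2 * derive1 (trunc_potential M) (u (n - 1)%N x)
                 + derive1 (trunc_potential M) (u (n - 2)%N x)
                 - S * dt * (u n x - u (n - 1)%N x))})
    (S_ge : 3 * alpha * (3 * M ^+ 2 - 1) / (2 * (1 + alpha))
            * (3 * gamma * Gamma (3 - alpha) * (3 * M ^+ 2 - 1)
               / (2 * alpha * (1 + alpha))) `^ alpha^-1 <= S) :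
  forall n, (2 <= n)%N ->
    modified_energy Omega alpha gamma eps M dt u n <=
    modified_energy Omega alpha gamma eps M dt u (n - 1).
Proof.
move=> [|[|m]] // _.
have mO : measurable Omega by case: dom => oO _ _ _; exact: measurable_open_rV.
have Ofin : (lebesgue_rV d Omega < +oo)%E.
  by case: dom => _ _ _ bO; exact: bounded_set_fin_measure.
pose L := 3 * M ^+ 2 - 1.
have L0 : 0 < L by have : 1 <= M ^+ 2 by [rewrite exprn_ege1]; rewrite /L; lra.
have Gam0 : 0 < Gamma (3 - alpha) by apply: Gamma_gt0; lra.
have G0 : 0 < (Gamma (3 - alpha) * dt `^ alpha)^-1.
  by rewrite invr_gt0 mulr_gt0 ?powR_gt0.
(* The bound on [S] is that of [stabilization_bound] for the constant that the
   memory inequality leaves in front of [dt^(- alpha)]. *)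
have stab : 3 / 2 * L <=
    alpha * (Gamma (3 - alpha) * dt `^ alpha)^-1 / gamma + S * dt.
  have A0 : 0 < alpha / (gamma * Gamma (3 - alpha)).
    by rewrite divr_gt0// mulr_gt0.
  have k0 : 0 < 3 / 2 * L by lra.
  have := stabilization_bound alpha_gt0 A0 k0 dt_gt0 (S := S).
  rewrite (_ : _ * (dt `^ alpha)^-1 = alpha * (Gamma (3 - alpha) * dt `^ alpha)^-1 / gamma);
    last by field; rewrite !gt_eqF// powR_gt0.
  apply; apply: le_trans S_ge; rewrite le_eqVlt; apply/orP; left; apply/eqP.
  congr (_ * _ `^ _); rewrite -/L; field; lra.
have Lu k : L2 Omega (u k) by have [] := uH2 k.
pose h i := weak_deriv Omega [:: i] (u m.+2).
pose k i := weak_deriv Omega [:: i] (u m.+1).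
pose g i := weak_deriv Omega [:: i; i] (u m.+2).
have Lh n i : L2 Omega (weak_deriv Omega [:: i] (u n)).
  by have [] := weak_derivP (uH2 n) (isT : size [:: i] <= 2)%N.
have Lg i : L2 Omega (g i).
  by have [] := weak_derivP (uH2 m.+2) (isT : size [:: i; i] <= 2)%N.
(* [eps^2 grad u_n . grad (u_n - u_(n-1))] added to the Laplacian term has zero
   integral by Green's formula in each direction. *)
have green_diff : has_integral Omega (fun x => eps ^+ 2 *
    \sum_(i < d) (g i x * (u m.+2 x - u m.+1 x) + h i x * (h i x - k i x))) 0.
  rewrite -[X in has_integral _ _ X](mulr0 (eps ^+ 2)); apply: has_integralZ => //.
  rewrite [X in has_integral _ _ X](_ : 0 = \sum_(i < d) 0); last by rewrite big1_eq.
  apply: has_integral_sum => // i _.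
  have int f1 f2 : L2 Omega f1 -> L2 Omega f2 -> has_integral Omega
      (fun x => f1 x * f2 x) (\int[lebesgue_rV d]_(x in Omega) (f1 x * f2 x)).
    by move=> ? ?; split => //; exact: L2_integrableM.
  have := has_integralD mO (has_integralB mO (int _ _ (Lg i) (Lu m.+2)) (int _ _ (Lg i) (Lu m.+1)))
    (has_integralB mO (int _ _ (Lh m.+2 i) (Lh m.+2 i)) (int _ _ (Lh m.+2 i) (Lh m.+1 i))).
  rewrite (green mO Ofin i (uH2 m.+2) (uH10 m.+2)).
  rewrite (green mO Ofin i (uH2 m.+2) (uH10 m.+1)).
  rewrite [X in has_integral _ _ X](_ : _ = 0); last by ring.
  by under eq_fun do rewrite -!mulrBr.
have EB := has_integralB mO
  (has_integral_energy_density mO Ofin alpha gamma eps dt m.+2 M_ge1 uH2)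
  (has_integral_energy_density mO Ofin alpha gamma eps dt m.+1 M_ge1 uH2).
rewrite subn1 /= -subr_le0; apply: (has_integral_le_ae mO EB green_diff).
have sch := scheme m.+2 isT.
apply: filterS sch => x sch Ox.
have := sch Ox; rewrite !(derive1_trunc_potential M_ge1) subn1 subn2 /= => scx.
have := energy_density_decay alpha_gt0 alpha_lt1 M_ge1 gamma_gt0 G0 stab
  (v := fun k => u k x) scx.
rewrite /weak_laplacian /weak_grad_sqr => dec.
(* Pointwise, half the change of the squared gradient is the scalar product above
   minus half the square of the gradient increment. *)
have sq : eps ^+ 2 * \sum_(i < d) (g i x * (u m.+2 x - u m.+1 x) + h i x * (h i x - k i x)) =
  eps ^+ 2 * ((\sum_(i < d) g i x) * (u m.+2 x - u m.+1 x))
  + eps ^+ 2 / 2 * (\sum_(i < d) h i x ^+ 2) - eps ^+ 2 / 2 * (\sum_(i < d) k i x ^+ 2)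
  + eps ^+ 2 / 2 * \sum_(i < d) (h i x - k i x) ^+ 2.
  rewrite mulr_suml !mulr_sumr -!big_split /= -sumrB -big_split /=.
  by apply: eq_bigr => i _; field.
rewrite sq.
have : 0 <= eps ^+ 2 / 2 * \sum_(i < d) (h i x - k i x) ^+ 2.
  by rewrite mulr_ge0 ?divr_ge0 ?sqr_ge0// sumr_ge0// => i _; exact: sqr_ge0.
move: dec; rewrite /g /h /k; lra.
Qed.
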